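(* Let $a,b\in I$ with $a<b$ and $a\le s_0\le b$, and let $1<p<\infty$, $1<p'<\infty$ with $\frac1p+\frac1{p'}=1$. Let $f,g:I\times I\to\mathbb{C}$ be functions such that $f(x,\cdot)\in\mathscr{L}^p_\beta[a,b]$ and $g(x,\cdot)\in\mathscr{L}^{p'}_\beta[a,b]$ for every $x\in[a,b]_\beta$, and such that the functions $y\mapsto\int_a^b|f(x,y)|^p\,d_\beta x$ and $y\mapsto\int_a^b|g(x,y)|^{p'}\,d_\beta x$ are finite on $[a,b]_\beta$ and belong to $\mathscr{L}^1_\beta[a,b]$. Then $$\int_a^b\int_a^b|f(x,y)g(x,y)|\,d_\beta x\,d_\beta y\le\left(\int_a^b\int_a^b|f(x,y)|^p\,d_\beta x\,d_\beta y\right)^{\frac1p}\left(\int_a^b\int_a^b|g(x,y)|^{p'}\,d_\beta x\,d_\beta y\right)^{\frac1{p'}} .$$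
   Context: Setting: $I\subseteq\mathbb{R}$ is an interval and $\beta:I\to I$ is a strictly increasing continuous function with exactly one fixed point $s_0\in I$, satisfying $(t-s_0)(\beta(t)-t)\le 0$ for all $t\in I$, with equality only if $t=s_0$. Write $\beta^0(t)=t$ and $\beta^k$ for the $k$-fold composition of $\beta$ with itself. For $a,b\in I$, $[a,b]_\beta:=\{\beta^k(a):k\ge 0\}\cup\{\beta^k(b):k\ge 0\}\cup\{s_0\}$. The $\beta$-integral is $\int_a^b h\,d_\beta:=\int_{s_0}^b h\,d_\beta-\int_{s_0}^a h\,d_\beta$, where $\int_{s_0}^x h\,d_\beta:=\sum_{k=0}^{\infty}\big(\beta^k(x)-\beta^{k+1}(x)\big)h\big(\beta^k(x)\big)$; also written $\int_a^b h(x)\,d_\beta x$. The function $h$ is $\beta$-integrable on $[a,b]$ if these series converge for $x=a$ and $x=b$. For $1\le p<\infty$, $\mathscr{L}^p_\beta[a,b]$ is the set of functions $h$ such that $|h|^p$ is $\beta$-integrable on $[a,b]$ (only the values of $h$ on $[a,b]_\beta$ matter). Double integrals are iterated: first in $x$ for fixed $y$, then in $y$. *)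

(* Defs.v *)
From HB Require Import structures.
From mathcomp Require Import all_boot all_order all_algebra.
From mathcomp Require Import all_classical all_reals.
From mathcomp Require Import topology normedtype sequences exp.
From mathcomp Require Export complex.
Set Implicit Arguments.
Unset Strict Implicit.
Unset Printing Implicit Defensive.
Import Order.TTheory GRing.Theory Num.Theory.
Import numFieldNormedType.Exports.

Local Open Scope classical_set_scope.
Local Open Scope complex_scope.
Local Open Scope ring_scope.

(* Functions on I (resp. I x I) are represented by total functions on R
   (resp. R -> R -> _); only their values on I are constrained or used. *)
Record beta_setting (R : realType) (I : interval R) (beta : R -> R) (s0 : R)
    : Prop := BetaSetting {
  beta_stable : {in I, forall t, beta t \in I};
  beta_increasing : {in I &, forall s t, s < t -> beta s < beta t};
  beta_continuous : {within [set` I], continuous beta};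
  beta_fixed_in : s0 \in I;
  beta_fixed : beta s0 = s0;
  beta_fixed_unique : {in I, forall t, beta t = t -> t = s0};
  beta_sign : {in I, forall t, (t - s0) * (beta t - t) <= 0};
  beta_sign_eq : {in I, forall t, (t - s0) * (beta t - t) = 0 -> t = s0} }.

Definition beta_itv (R : realType) (beta : R -> R) (s0 a b : R) : set R :=
  [set iter k beta a | k in [set: nat]] `|`
  [set iter k beta b | k in [set: nat]] `|` [set s0].

Definition beta_term (R : realType) (beta : R -> R) (x : R) (h : R -> R)
    (k : nat) : R :=
  (iter k beta x - iter k.+1 beta x) * h (iter k beta x).

(* The integral from s0 to x: its defining series involves s0 only through
   the limit of the iterates. The value is meaningful only when the series
   converges. *)
Definition beta_int0 (R : realType) (beta : R -> R) (x : R) (h : R -> R) : R :=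
  limn (series (beta_term beta x h)).

Definition beta_int (R : realType) (beta : R -> R) (a b : R) (h : R -> R) : R :=
  beta_int0 beta b h - beta_int0 beta a h.

Definition beta_integrable (R : realType) (beta : R -> R) (a b : R)
    (h : R -> R) : Prop :=
  cvgn (series (beta_term beta a h)) /\ cvgn (series (beta_term beta b h)).

(* R-valued modulus; the norm `|z| of R[i] is R[i]-valued. *)
Definition cmod (R : realType) (z : R[i]) : R := Normc.normc z.

(* powR gives 0 `^ p = 0 for p != 0. *)
Definition beta_Lp (R : realType) (beta : R -> R) (p a b : R)
    (h : R -> R[i]) : Prop :=
  beta_integrable beta a b (fun x => cmod (h x) `^ p).

(* Main.v *)
(* A beta-integral over [a, b] with a <= s0 <= b is a sum of two series with
   nonnegative weights, so Hoelder's inequality for finite sums passes to the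
   limit: if 0 <= h <= F^(1/p) G^(1/p') on the orbits of a and b, then
   int h <= (int F)^(1/p) (int G)^(1/p'). Applying this in x with F = |f|^p and
   G = |g|^p' bounds the inner integral by exactly the hypothesis needed to
   apply it again in y. *)
Require Import Defs.
From HB Require Import structures.
From mathcomp Require Import all_boot all_order all_algebra.
From mathcomp Require Import all_classical all_reals.
From mathcomp Require Import topology normedtype sequences exp.
From mathcomp Require Import complex hoelder.
Import Order.TTheory GRing.Theory Num.Theory.
Import numFieldNormedType.Exports.

Local Open Scope classical_set_scope.
Local Open Scope complex_scope.
Local Open Scope ring_scope.

Section HolderSeries.
Set Implicit Arguments.
Unset Strict Implicit.
Context {R : realType} (p q : R).
Hypotheses (p0 : 0 < p) (q0 : 0 < q) (pq : p^-1 + q^-1 = 1).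

Lemma powRVK (x r : R) : r != 0 -> 0 <= x -> (x `^ r^-1) `^ r = x.
Proof. by move=> r0 x0; rewrite -powRrM mulVf// powRr1. Qed.

Lemma powRKV (x r : R) : r != 0 -> 0 <= x -> (x `^ r) `^ r^-1 = x.
Proof. by move=> r0 x0; rewrite -powRrM mulfV// powRr1. Qed.

Lemma ler_powRV_mul (r x1 x2 y1 y2 : R) : 0 <= x1 <= x2 -> 0 <= y1 <= y2 ->
  x1 `^ p^-1 * y1 `^ q^-1 <= x2 `^ p^-1 * y2 `^ q^-1.
Proof.
move=> /andP[x10 x12] /andP[y10 y12].
rewrite ler_pM ?powR_ge0// ge0_ler_powR ?invr_ge0 ?nnegrE//;
  by [exact: ltW | exact: le_trans x12 | exact: le_trans y12].
Qed.

(** This is [hoelder2] applied to the roots [xi]^ p^-1[and]yi [^ q^-1]. The bound keeps its shape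
    under addition, so it serves both as the induction step for partial sums and to join the series
    of [a] and [b]. *)
Lemma hoelder_add (x1 x2 y1 y2 z1 z2 : R) :
  0 <= x1 -> 0 <= x2 -> 0 <= y1 -> 0 <= y2 ->
  z1 <= x1 `^ p^-1 * y1 `^ q^-1 -> z2 <= x2 `^ p^-1 * y2 `^ q^-1 ->
  z1 + z2 <= (x1 + x2) `^ p^-1 * (y1 + y2) `^ q^-1.
Proof.
move=> x10 x20 y10 y20 z1_le z2_le; apply: le_trans (lerD z1_le z2_le) _.
apply: le_trans (hoelder2 _ _ _ _ p0 q0 pq) _; rewrite ?powR_ge0//.
by rewrite !powRVK// gt_eqF.
Qed.

(** Since the exponents add up to 1, [w] factors as [w]^ p^-1 * w [^ q^-1], one share for each side
    of the product. *)
Lemma hoelder_weight (w x y z : R) : 0 <= w -> 0 <= x -> 0 <= y ->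
  z <= x `^ p^-1 * y `^ q^-1 ->
  w * z <= (w * x) `^ p^-1 * (w * y) `^ q^-1.
Proof.
move=> w0 x0 y0 zle; rewrite !powRM// mulrACA -powRD; last first.
  (* [powRD] excludes a zero base only when the exponents add up to 0; here they add up to 1, so
     [w = 0] is allowed. *)
  by rewrite pq oner_eq0.
by rewrite pq powRr1// ler_wpM2l.
Qed.

Lemma hoelder_sum (u v w : R^nat) n :
  (forall k, 0 <= u k) -> (forall k, 0 <= v k) ->
  (forall k, w k <= u k `^ p^-1 * v k `^ q^-1) ->
  series w n <= series u n `^ p^-1 * series v n `^ q^-1.
Proof.
move=> u0 v0 wuv; elim: n => [|n IHn].
  by rewrite /series/= !big_geq// mulr_ge0// powR_ge0.
by rewrite !seriesSr hoelder_add ?sumr_ge0.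
Qed.

Lemma nneg_series_le_lim (u : R^nat) n : (forall k, 0 <= u k) ->
  cvgn (series u) -> series u n <= limn (series u).
Proof.
by move=> u0 cu; apply: nondecreasing_cvgn_le => //; exact: nondecreasing_series.
Qed.

Lemma nneg_series_lim_ge0 (u : R^nat) : (forall k, 0 <= u k) ->
  cvgn (series u) -> 0 <= limn (series u).
Proof. by move=> u0 cu; apply: limr_ge => //; near=> n; exact: sumr_ge0.
Unshelve. all: by end_near. Qed.

(** The limits of the two dominating series bound every partial sum of [w], which converges by
    monotonicity. Convergence belongs to the conclusion because [limn] says nothing about a
    divergent series. *)
Lemma hoelder_series (u v w : R^nat) :
  (forall k, 0 <= u k) -> (forall k, 0 <= v k) -> (forall k, 0 <= w k) ->
  (forall k, w k <= u k `^ p^-1 * v k `^ q^-1) ->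
  cvgn (series u) -> cvgn (series v) ->
  cvgn (series w) /\
  limn (series w) <= limn (series u) `^ p^-1 * limn (series v) `^ q^-1.
Proof.
move=> u0 v0 w0 wuv cu cv.
have bound n : series w n <=
    limn (series u) `^ p^-1 * limn (series v) `^ q^-1.
  apply: le_trans (hoelder_sum _ u0 v0 wuv) _.
  by rewrite ler_powRV_mul// sumr_ge0//= nneg_series_le_lim.
have cw : cvgn (series w).
  apply: nondecreasing_is_cvgn; first exact: nondecreasing_series.
  by exists (limn (series u) `^ p^-1 * limn (series v) `^ q^-1) => _ [n _ <-].
by split=> //; apply: limr_le => //; exact: nearW.
Qed.

End HolderSeries.

Section BetaIntegral.
Set Implicit Arguments.
Unset Strict Implicit.
Context {R : realType} {I : interval R} {beta : R -> R} {s0 a b : R}.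
Hypotheses (hbeta : beta_setting I beta s0) (aI : a \in I) (bI : b \in I).
Hypotheses (leas0 : a <= s0) (les0b : s0 <= b).

Lemma iter_beta_in (x : R) k : x \in I -> iter k beta x \in I.
Proof. by move=> xI; elim: k => //= k; exact: beta_stable hbeta _. Qed.

Lemma beta_homo : {in I &, {homo beta : s t / s <= t}}.
Proof.
move=> s t sI tI; rewrite le_eqVlt => /predU1P[->//|st].
by apply/ltW/(beta_increasing hbeta).
Qed.

(** A monotone map fixing [s0] keeps each side of [s0] stable, so the orbit never crosses it. *)
Lemma iter_beta_ge k : s0 <= iter k beta b.
Proof.
elim: k => //= k IHk; rewrite -(beta_fixed hbeta).
by apply: beta_homo => //; [exact: beta_fixed_in hbeta|exact: iter_beta_in].
Qed.

Lemma iter_beta_le k : iter k beta a <= s0.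
Proof.
elim: k => //= k IHk; rewrite -(beta_fixed hbeta).
by apply: beta_homo => //; [exact: iter_beta_in|exact: beta_fixed_in hbeta].
Qed.

Lemma beta_weightb_ge0 k : 0 <= iter k beta b - iter k.+1 beta b.
Proof.
have := beta_sign hbeta (iter_beta_in k bI); rewrite /=.
(* At [s0] the sign condition reads [0 <= 0] and is uninformative, but there the weight vanishes;
   strictly to the right, the positive factor can be cancelled. *)
have := iter_beta_ge k; rewrite le_eqVlt => /predU1P[<-|s0k].
  by rewrite (beta_fixed hbeta) subrr.
by rewrite pmulr_rle0 ?subr_gt0// subr_le0 subr_ge0.
Qed.

(** Left of [s0] the sign condition gives [t <= beta t], so the difference is reversed with respect
    to [beta_term]. *)
Lemma beta_weighta_ge0 k : 0 <= iter k.+1 beta a - iter k beta a.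
Proof.
have := beta_sign hbeta (iter_beta_in k aI); rewrite /=.
have := iter_beta_le k; rewrite le_eqVlt => /predU1P[->|s0k].
  by rewrite (beta_fixed hbeta) subrr.
by rewrite nmulr_rle0 ?subr_lt0.
Qed.

Lemma beta_itvb k : beta_itv beta s0 a b (iter k beta b).
Proof. by left; right; exists k. Qed.

Lemma beta_itva k : beta_itv beta s0 a b (iter k beta a).
Proof. by left; left; exists k. Qed.

Lemma eq_beta_term (x : R) (h1 h2 : R -> R) :
  (forall k, h1 (iter k beta x) = h2 (iter k beta x)) ->
  beta_term beta x h1 = beta_term beta x h2.
Proof. by move=> h12; apply/funext => k; rewrite /beta_term h12. Qed.

Lemma eq_beta_integrable (h1 h2 : R -> R) :
  (forall x, beta_itv beta s0 a b x -> h1 x = h2 x) ->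
  beta_integrable beta a b h1 -> beta_integrable beta a b h2.
Proof.
move=> h12; rewrite /beta_integrable.
rewrite (@eq_beta_term a h1 h2) => [|k]; last exact/h12/beta_itva.
by rewrite (@eq_beta_term b h1 h2) => [//|k]; exact/h12/beta_itvb.
Qed.

Lemma beta_termb_ge0 (h : R -> R) k :
  (forall x, beta_itv beta s0 a b x -> 0 <= h x) -> 0 <= beta_term beta b h k.
Proof. by move=> h0; rewrite mulr_ge0 ?beta_weightb_ge0//; exact/h0/beta_itvb. Qed.

Lemma oppr_beta_terma_ge0 (h : R -> R) k :
  (forall x, beta_itv beta s0 a b x -> 0 <= h x) ->
  0 <= (- beta_term beta a h) k.
Proof.
move=> h0; rewrite /= -mulNr opprB mulr_ge0 ?beta_weighta_ge0//.
exact/h0/beta_itva.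
Qed.

(** Moving the minus sign inside the series at [a] makes both series nonnegative when [h] is, as the
    Hoelder bounds require. *)
Lemma beta_intE (h : R -> R) : beta_integrable beta a b h ->
  beta_int beta a b h =
  limn (series (beta_term beta b h)) + limn (series (- beta_term beta a h)).
Proof. by case=> ca cb; rewrite lim_seriesN. Qed.

Lemma beta_int_ge0 (h : R -> R) :
  (forall x, beta_itv beta s0 a b x -> 0 <= h x) ->
  beta_integrable beta a b h -> 0 <= beta_int beta a b h.
Proof.
move=> h0 ih; rewrite beta_intE//; case: ih => ca cb.
by apply: addr_ge0; apply: nneg_series_lim_ge0; rewrite ?is_cvg_seriesN//;
  move=> k; [exact: beta_termb_ge0|exact: oppr_beta_terma_ge0].
Qed.

(** [hoelder_series] treats each orbit separately and [hoelder_add] combines the two bounds.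
    Integrability of [h] is derived too, since the outer integration relies on it for the inner
    integrals. *)
Lemma hoelder_beta_int (p q : R) (F G h : R -> R) :
  0 < p -> 0 < q -> p^-1 + q^-1 = 1 ->
  (forall x, beta_itv beta s0 a b x -> 0 <= F x) ->
  (forall x, beta_itv beta s0 a b x -> 0 <= G x) ->
  (forall x, beta_itv beta s0 a b x -> 0 <= h x) ->
  (forall x, beta_itv beta s0 a b x -> h x <= F x `^ p^-1 * G x `^ q^-1) ->
  beta_integrable beta a b F -> beta_integrable beta a b G ->
  beta_integrable beta a b h /\
  beta_int beta a b h <=
    beta_int beta a b F `^ p^-1 * beta_int beta a b G `^ q^-1.
Proof.
move=> p0 q0 pq F0 G0 h0 hFG iF iG.
have [cFa cFb] := iF; have [cGa cGb] := iG.
have [chb leb] : cvgn (series (beta_term beta b h)) /\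
    limn (series (beta_term beta b h)) <=
    limn (series (beta_term beta b F)) `^ p^-1 *
    limn (series (beta_term beta b G)) `^ q^-1.
  apply: hoelder_series => // k; try exact: beta_termb_ge0.
  have xk := beta_itvb k.
  by apply: hoelder_weight; rewrite ?beta_weightb_ge0 ?F0 ?G0 ?hFG.
have [cha lea] : cvgn (series (- beta_term beta a h)) /\
    limn (series (- beta_term beta a h)) <=
    limn (series (- beta_term beta a F)) `^ p^-1 *
    limn (series (- beta_term beta a G)) `^ q^-1.
  apply: hoelder_series; rewrite ?is_cvg_seriesN// => k;
    try exact: oppr_beta_terma_ge0.
  have xk := beta_itva k; rewrite /= -!mulNr !opprB.
  by apply: hoelder_weight; rewrite ?beta_weighta_ge0 ?F0 ?G0 ?hFG.
have ih : beta_integrable beta a b h by split=> //; rewrite -is_cvg_seriesN.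
split=> //; rewrite !beta_intE//.
apply: hoelder_add => //; apply: nneg_series_lim_ge0; rewrite ?is_cvg_seriesN//;
  by move=> k; (exact: beta_termb_ge0 || exact: oppr_beta_terma_ge0).
Qed.

(** The modulus of [(h x)%:C] to the power 1 is the absolute value of [h x]; it is known to equal
    [h x] only on the orbits, which is all that integrability sees. *)
Lemma beta_L1_integrable (h : R -> R) :
  (forall x, beta_itv beta s0 a b x -> 0 <= h x) ->
  beta_Lp beta 1 a b (fun x => (h x)%:C) -> beta_integrable beta a b h.
Proof.
move=> h0; apply: eq_beta_integrable => x /h0 hx0.
by rewrite powRr1 /cmod/= expr0n/= addr0 sqrtr_sqr ?normr_ge0 ?ger0_norm.
Qed.

End BetaIntegral.

Lemma cmod_ge0 (R : realType) (z : R[i]) : 0 <= cmod z.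
Proof. by case: z => x y; exact: sqrtr_ge0. Qed.

Theorem proposition3p5 (R : realType) (I : interval R) (beta : R -> R) (s0 : R)
  (hbeta : beta_setting I beta s0)
  (a b : R) (aI : a \in I) (bI : b \in I) (ltab : a < b)
  (leas0 : a <= s0) (les0b : s0 <= b)
  (p p' : R) (p_gt1 : 1 < p) (p'_gt1 : 1 < p') (pp' : p^-1 + p'^-1 = 1)
  (f g : R -> R -> R[i])
  (fLp : forall x, beta_itv beta s0 a b x -> beta_Lp beta p a b (f x))
  (gLp : forall x, beta_itv beta s0 a b x -> beta_Lp beta p' a b (g x))
  (f_fin : forall y, beta_itv beta s0 a b y ->
     beta_integrable beta a b (fun x => cmod (f x y) `^ p))
  (g_fin : forall y, beta_itv beta s0 a b y ->
     beta_integrable beta a b (fun x => cmod (g x y) `^ p'))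
  (f_L1 : beta_Lp beta 1 a b
     (fun y => (beta_int beta a b (fun x => cmod (f x y) `^ p))%:C))
  (g_L1 : beta_Lp beta 1 a b
     (fun y => (beta_int beta a b (fun x => cmod (g x y) `^ p'))%:C)) :
  [/\ (forall y, beta_itv beta s0 a b y ->
         beta_integrable beta a b (fun x => cmod (f x y * g x y))),
      beta_integrable beta a b
        (fun y => beta_int beta a b (fun x => cmod (f x y * g x y)))
    & beta_int beta a b
        (fun y => beta_int beta a b (fun x => cmod (f x y * g x y)))
      <= beta_int beta a b
           (fun y => beta_int beta a b (fun x => cmod (f x y) `^ p)) `^ p^-1
         * beta_int beta a b
           (fun y => beta_int beta a b (fun x => cmod (g x y) `^ p')) `^ p'^-1].
Proof.
have p0 : 0 < p := lt_trans ltr01 p_gt1.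
have p'0 : 0 < p' := lt_trans ltr01 p'_gt1.
pose F y := beta_int beta a b (fun x => cmod (f x y) `^ p).
pose G y := beta_int beta a b (fun x => cmod (g x y) `^ p').
(* The sign is available only for [y] in [beta_itv], where [f_fin] makes the defining series
   converge. *)
have F0 y : beta_itv beta s0 a b y -> 0 <= F y.
  move=> /f_fin; apply: (beta_int_ge0 hbeta) => // x _; exact: powR_ge0.
have G0 y : beta_itv beta s0 a b y -> 0 <= G y.
  move=> /g_fin; apply: (beta_int_ge0 hbeta) => // x _; exact: powR_ge0.
have fg y : beta_itv beta s0 a b y ->
    beta_integrable beta a b (fun x => cmod (f x y * g x y)) /\
    beta_int beta a b (fun x => cmod (f x y * g x y)) <=
      F y `^ p^-1 * G y `^ p'^-1.
  move=> yab.
  apply: (@hoelder_beta_int _ _ _ _ _ _ hbeta aI bI leas0 les0b p p'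
    (fun x => cmod (f x y) `^ p) (fun x => cmod (g x y) `^ p')
    (fun x => cmod (f x y * g x y)) p0 p'0 pp' _ _ _ _ (f_fin _ yab) (g_fin _ yab)).
  - by move=> x _; exact: powR_ge0.
  - by move=> x _; exact: powR_ge0.
  - by move=> x _; exact: cmod_ge0.
  (* The roots undo the powers, so the pointwise bound is the equality case given by
     multiplicativity of the modulus. *)
  move=> x _; rewrite (powRKV (lt0r_neq0 p0) (cmod_ge0 _)).
  rewrite (powRKV (lt0r_neq0 p'0) (cmod_ge0 _)).
  by rewrite /cmod Normc.normcM.
have [iH leH] : beta_integrable beta a b
      (fun y => beta_int beta a b (fun x => cmod (f x y * g x y))) /\
    beta_int beta a b
      (fun y => beta_int beta a b (fun x => cmod (f x y * g x y))) <=
    beta_int beta a b F `^ p^-1 * beta_int beta a b G `^ p'^-1.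
  apply: (@hoelder_beta_int _ _ _ _ _ _ hbeta aI bI leas0 les0b p p' F G) => //.
  (* The first application supplies the convergence needed for the inner integral of the product to
     be nonnegative. *)
  - move=> y /fg[ify _]; apply: (beta_int_ge0 hbeta) ify => // x _.
    exact: cmod_ge0.
  - by move=> y /fg[].
  - exact: (beta_L1_integrable F0 f_L1).
  - exact: (beta_L1_integrable G0 g_L1).
by split=> // y /fg[].
Qed.
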